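(* Let $A$ be a commutative ring with $1$ and let $f\in A[X]$ be a strict real zero polynomial of degree $n$. Then there exist an integer $r\le (2p(A)+1)n$ and a symmetric matrix $M\in\operatorname{Sym}_r(A)$ such that $f$ divides the characteristic polynomial $\det(X\cdot \mathrm{I}_r-M)$ in $A[X]$.
   Context: $\operatorname{Sym}_r(A)$ is the set of symmetric $r\times r$ matrices with entries in $A$. $\Sigma A^2$ denotes the set of finite sums $a_1^2+\dots+a_k^2$ with $a_i\in A$. The Pythagoras number $p(A)$ is the smallest integer $q$ such that every element of $\Sigma A^2$ is a sum of $q$ squares of elements of $A$; if no such integer exists, $p(A)=\infty$ (and then the bound on $r$ is vacuous). A monic polynomial $f\in A[X]$ is a real zero polynomial if for every ring homomorphism $\varphi:A\to R$ into a real closed field $R$, the image of $f$ in $R[X]$ has all its zeros (in the algebraic closure of $R$) in $R$; it is a strict real zero polynomial if moreover, for every such $\varphi$, all these zeros are simple. *)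

(* Defs.v *)
From HB Require Import structures.
From mathcomp Require Import all_boot all_order all_algebra.
Set Implicit Arguments. Unset Strict Implicit. Unset Printing Implicit Defensive.
Import Order.TTheory GRing.Theory Num.Theory.
Local Open Scope ring_scope.

Definition sos_in_q_squares (A : comNzRingType) (q : nat) : Prop :=
  forall s : seq A, exists v : 'I_q -> A,
    \sum_(a <- s) a ^+ 2 = \sum_(i < q) v i ^+ 2.

Definition pythagoras_number (A : comNzRingType) (p : option nat) : Prop :=
  match p with
  | Some q => sos_in_q_squares A q /\ (forall q', sos_in_q_squares A q' -> (q <= q')%N)
  | None => forall q, ~ sos_in_q_squares A q
  end.

(* f is a real zero polynomial: monic and for every ring morphism into a real
   closed field R, its image splits into linear factors over R (all zeros in
   the algebraic closure lie in R). *)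
Definition real_zero_poly (A : comNzRingType) (f : {poly A}) : Prop :=
  f \is monic /\
  forall (R : rcfType) (phi : {rmorphism A -> R}),
    exists s : seq R, map_poly phi f = \prod_(x <- s) ('X - x%:P).

Definition strict_real_zero_poly (A : comNzRingType) (f : {poly A}) : Prop :=
  f \is monic /\
  forall (R : rcfType) (phi : {rmorphism A -> R}),
    exists s : seq R, uniq s /\ map_poly phi f = \prod_(x <- s) ('X - x%:P).

(* Main.v *)
Require Import Defs.
From HB Require Import structures.
From mathcomp Require Import all_boot all_order all_algebra.
From mathcomp Require Import boolp classical_sets ring lra zify.
Set Implicit Arguments. Unset Strict Implicit. Unset Printing Implicit Defensive.
Import Order.TTheory GRing.Theory Num.Theory.
Local Open Scope ring_scope.

(* Let [C] be the companion matrix of [f] and [H] the matrix [tr (C ^ (i + j))].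
   At every morphism to a real closed field, [H] is the Gram matrix [V V^T] of the
   Vandermonde matrix of the distinct roots of [f], hence positive definite, and so
   is [c H - 1] for a suitable [c] in [A].  The Positivstellensatz makes each pivot
   of a Gaussian elimination of [c H - 1] invertible up to sums of squares, so that
   [(1 + t) (c H - 1) = W^T D W] with [t] and the entries of [D] sums of squares.
   Then [(1 + t) c H = 1 + N N^T], where [N] has [2 p(A)] blocks of size [n], and
   [C H = H C^T] turns [C] into the action of a symmetric matrix of size
   [n + 2 p(A) n] on the row space of [row_mx 1 N].
   The Positivstellensatz itself needs a real closed field above any preordering
   of a ring: a maximal preordering gives an ordered field, and the ordered field
   is closed up by adjoining roots of polynomials that change sign. *)

(** * Preorderings and ordered fields *)

Definition preordering (S : comNzRingType) (T : set S) : Prop :=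
  [/\ forall x y, T x -> T y -> T (x + y),
      forall x y, T x -> T y -> T (x * y) &
      forall x, T (x ^+ 2)].

(** The last condition makes the support, the intersection of [P] and [- P], a prime ideal, so that
    the quotient by it is an integral domain. *)
Definition prime_cone (S : comNzRingType) (P : set S) : Prop :=
  [/\ preordering P, ~ P (- 1), forall x, P x \/ P (- x) &
      forall x y, P (x * y) -> P (- (x * y)) ->
        P x /\ P (- x) \/ P y /\ P (- y)].

Section MaximalCone.
Local Open Scope classical_set_scope.
Local Open Scope ring_scope.
Variable S : comNzRingType.
Implicit Types (T P : set S) (x y : S).

Lemma preordering0 T : preordering T -> T 0.
Proof. by case=> _ _ /(_ 0); rewrite expr0n. Qed.

Lemma preordering1 T : preordering T -> T 1.
Proof. by case=> _ _ /(_ 1); rewrite expr1n. Qed.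

Lemma preordering_adjoin T x : preordering T ->
  preordering [set z | exists s t, [/\ T s, T t & z = s + t * x]].
Proof.
move=> prT; have [TD TM TX] := prT; split.
- move=> _ _ [s [t [Ts Tt ->]]] [u [v [Tu Tv ->]]]; exists (s + u), (t + v).
  by split; [exact: TD | exact: TD | rewrite mulrDl addrACA].
- move=> _ _ [s [t [Ts Tt ->]]] [u [v [Tu Tv ->]]].
  exists (s * u + t * v * x ^+ 2), (s * v + t * u); split.
  + by apply: TD; [exact: TM | apply: (TM); [exact: TM | exact: TX]].
  + by apply: TD; exact: TM.
  + by ring.
- move=> y; exists (y ^+ 2), 0; split; [exact: TX | exact: preordering0 |].
  by rewrite mul0r addr0.
Qed.

Lemma maximal_preordering T : preordering T -> ~ T (- 1) ->
  exists P, [/\ preordering P, ~ P (- 1), T `<=` P &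
    forall Q, preordering Q -> ~ Q (- 1) -> P `<=` Q -> Q `<=` P].
Proof.
move=> prT T1.
pose good P := [/\ preordering P, ~ P (- 1) & T `<=` P].
have [|A [[A0|[prA A1 TA]] maxA]] :=
    @Zorn_bigcup S (fun P => P = set0 \/ good P).
- move=> F FP totF.
  have [[B FB [b Bb]]|F0] := pselect (exists2 B, F B & B !=set0)%classic; last first.
    left; apply/seteqP; split=> // x [B FB Bx]; apply: F0; exists B => //.
    by exists x.
  have goodF C c : F C -> C c -> good C.
    by move=> FC Cc; case: (FP _ FC) => // C0; rewrite C0 in Cc.
  have [[BD BM BX] B1 TB] := goodF _ _ FB Bb.
  right; split; last by move=> x Tx; exists B => //; exact: TB.
    have common x y : (\bigcup_(X in F) X)%classic x ->
        (\bigcup_(X in F) X)%classic y -> exists C, [/\ F C, C x & C y].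
      move=> [C FC Cx] [D FD Dy]; have [CD|DC] := totF _ _ FC FD.
        by exists D; split => //; exact: CD.
      by exists C; split => //; exact: DC.
    split.
    + move=> x y Fx Fy; have [C [FC Cx Cy]] := common _ _ Fx Fy.
      by exists C => //; have [[CD _ _] _ _] := goodF _ _ FC Cx; exact: CD.
    + move=> x y Fx Fy; have [C [FC Cx Cy]] := common _ _ Fx Fy.
      by exists C => //; have [[_ CM _] _ _] := goodF _ _ FC Cx; exact: CM.
    + by move=> x; exists B.
  by move=> [C FC C1]; have [_ /(_ C1)] := goodF _ _ FC C1.
- exfalso; apply: (maxA T); last by right; split.
  rewrite A0; split => //; move/(_ 0); apply; exact: preordering0.
- exists A; split => // Q prQ Q1 AQ; apply: contrapT => QA.
  apply: (maxA Q); first by split.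
  by right; split => //; exact: subset_trans AQ.
Qed.

(** In a maximal preordering [P], adjoining any [x] outside [P] yields an identity [- 1 = s + t * x]
    with [s] and [t] in [P]. Multiplying two such identities puts [- 1] in [P], which gives both
    totality and primality of the support. *)
Lemma prime_cone_of_preordering T : preordering T -> ~ T (- 1) ->
  exists2 P, prime_cone P & T `<=` P.
Proof.
move=> prT T1; have [P [prP P1 TP maxP]] := maximal_preordering prT T1.
exists P => //; have [PD PM PX] := prP.
have P0 := preordering0 prP; have P_1 := preordering1 prP.
have escape x : ~ P x -> exists s t, [/\ P s, P t & - 1 = s + t * x].
  move=> Px; apply: contrapT => noT; apply: Px.
  apply: (maxP _ (preordering_adjoin x prP)) => //.
  + by move=> z Pz; exists z, 0; rewrite mul0r addr0; split.
  + by exists 0, 1; rewrite mul1r add0r.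
have tot x : P x \/ P (- x).
  have [|nPx] := pselect (P x); first by left.
  right; apply: contrapT => nPNx.
  have [s [t [Ps Pt e1]]] := escape _ nPx.
  have [u [v [Pu Pv e2]]] := escape _ nPNx.
  apply: P1; suff -> : - 1 = x ^+ 2 * (t * v) + (s + u + s * u).
    by apply: (PD); [apply: (PM) => //; exact: PM | apply: (PD); [exact: PD|exact: PM]].
  have etx : t * x = - 1 - s by rewrite e1 addrC addKr.
  have evx : v * x = 1 + u by apply: oppr_inj; rewrite opprD -mulrN e2 [u + _]addrC addrK.
  have -> : x ^+ 2 * (t * v) = (t * x) * (v * x) by ring.
  by rewrite etx evx; ring.
split => // x y Pxy PNxy.
have suppM z w : P z -> P (- z) -> P (w * z) /\ P (- (w * z)).
  move=> Pz PNz; case: (tot w) => Pw; split.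
  + exact: PM.
  + by rewrite -mulrN; exact: PM.
  + by rewrite -mulrNN; exact: PM.
  + by rewrite -mulNr; exact: PM.
(* If both [x] and [- x] are in [P], then [x] is in the support; otherwise a change of sign puts
   [- x] outside [P]. The same is done for [y]. *)
wlog nPx : x y Pxy PNxy / ~ P (- x) => [WL|].
  have [PNx|] := pselect (P (- x)); last by move=> h; exact: WL.
  have [Px|nPx] := pselect (P x); first by left.
  have := WL (- x) y; rewrite mulNr !opprK => /(_ PNxy Pxy nPx).
  by case=> [[]|]; [left|right].
wlog nPy : y Pxy PNxy / ~ P (- y) => [WL|].
  have [PNy|] := pselect (P (- y)); last by move=> h; exact: WL.
  have [Py|nPy] := pselect (P y); first by right.
  have := WL (- y); rewrite mulrN !opprK => /(_ PNxy Pxy nPy).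
  by case=> [|[]]; [left|right].
have [s [t [Ps Pt e1]]] := escape _ nPx.
have [u [v [Pu Pv e2]]] := escape _ nPy.
have etx : t * x = 1 + s by apply: oppr_inj; rewrite opprD -mulrN e1 [s + _]addrC addrK.
have evy : v * y = 1 + u by apply: oppr_inj; rewrite opprD -mulrN e2 [u + _]addrC addrK.
exfalso; apply: P1; suff -> : - 1 = - ((t * v) * (x * y)) + (s + u + s * u).
  apply: (PD); first by have [] := suppM _ (t * v) Pxy PNxy.
  by apply: (PD); [exact: PD|exact: PM].
by rewrite mulrACA etx evy; ring.
Qed.

End MaximalCone.

Section OrderedField.
Variables (F : fieldType) (Q : set F).
Hypotheses (QD : forall x y, Q x -> Q y -> Q (x + y))
  (QM : forall x y, Q x -> Q y -> Q (x * y))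
  (Qanti : forall x, Q x -> Q (- x) -> x = 0)
  (Qtotal : forall x, Q x \/ Q (- x)).

Let le (x y : F) := `[< Q (y - x) >].
Let lt (x y : F) := (y != x) && le x y.
Let norm (x : F) := if le 0 x then x else - x.

Let Q_ge0 x : le 0 x = `[< Q x >]. Proof. by rewrite /le subr0. Qed.
Let Q_le0 x : le x 0 = `[< Q (- x) >]. Proof. by rewrite /le sub0r. Qed.

Let le0_add x y : le 0 x -> le 0 y -> le 0 (x + y).
Proof. by rewrite !Q_ge0 => /asboolP Qx /asboolP Qy; apply/asboolP/QD. Qed.

Let le0_mul x y : le 0 x -> le 0 y -> le 0 (x * y).
Proof. by rewrite !Q_ge0 => /asboolP Qx /asboolP Qy; apply/asboolP/QM. Qed.

Let le0_anti x : le 0 x -> le x 0 -> x = 0.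
Proof. by rewrite Q_ge0 Q_le0 => /asboolP Qx /asboolP; exact: Qanti. Qed.

Let sub_ge0 x y : le 0 (y - x) = le x y.
Proof. by rewrite /le subr0. Qed.

Let le0_total x : le 0 x || le x 0.
Proof. by rewrite Q_ge0 Q_le0; apply/orP; case: (Qtotal x) => ?; [left|right]; apply/asboolP. Qed.

Let normN x : norm (- x) = norm x.
Proof.
rewrite /norm; have [le0x|] := boolP (le 0 x); last first.
  by case/orP: (le0_total x) => [->//|]; rewrite Q_le0 -Q_ge0 => ->.
have [le0Nx|_] := boolP (le 0 (- x)); last by rewrite opprK.
by rewrite (le0_anti le0x) ?oppr0 // Q_le0 -Q_ge0.
Qed.

Let ge0_norm x : le 0 x -> norm x = x.
Proof. by rewrite /norm => ->. Qed.

Let lt_def x y : lt x y = (y != x) && le x y. Proof. by []. Qed.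

Let orderedMixin := Num.IntegralDomain_isLeReal.Build F
  le0_add le0_mul le0_anti sub_ge0 le0_total normN ge0_norm lt_def.

Lemma ordered_field_of_cone : exists (K : realFieldType) (f : {rmorphism F -> K}),
  (forall x, (0 <= f x) = `[< Q x >]) /\ (forall z, exists x, z = f x).
Proof.
pose K : realFieldType := HB.pack F orderedMixin.
exists K; exists (idfun : {rmorphism F -> F}); split; first exact: Q_ge0.
by move=> z; exists z.
Qed.

End OrderedField.

Lemma fractionE (D : idomainType) (z : {fraction D}) :
  exists x y, y != 0 /\ z = FracField.tofrac x / FracField.tofrac y.
Proof.
elim/quotW: z => r; exists (frac r).1, (frac r).2; split; first exact: denom_ratioP.
rewrite /GRing.inv /GRing.mul /=.
rewrite !piE /FracField.mulf /FracField.invf.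
rewrite !numden_Ratio ?oner_neq0 ?denom_ratioP // mul1r mulr1.
by rewrite FracField.Ratio_numden.
Qed.

Section ClassicalInverse.
Variable B : comNzRingType.
Hypothesis mulf_eq0B : GRing.integral_domain_axiom B.

Let invertible (x : B) := exists y, y * x = 1.
Let unitB : pred B := fun x => `[< invertible x >].
Let invB (x : B) :=
  if pselect (invertible x) is left ex then projT1 (cid ex) else x.

Let mulVB : {in unitB, left_inverse 1 invB *%R}.
Proof.
by move=> x /asboolP ux; rewrite /invB; case: pselect => // ex; case: cid.
Qed.

Let unitB_def (x y : B) : y * x = 1 -> unitB x.
Proof. by move=> yx; apply/asboolP; exists y. Qed.

Let invB_out : {in [predC unitB], invB =1 id}.
Proof. by move=> x /asboolPn; rewrite /invB; case: pselect. Qed.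

(** Fractions are formed over an [idomainType], which carries a unit predicate and an inverse
    operation; both are supplied on [B] by classical choice. *)
Lemma fraction_field : exists (F : fieldType) (f : {rmorphism B -> F}),
  (forall x, (f x == 0) = (x == 0)) /\
  (forall z, exists x y, y != 0 /\ z = f x / f y).
Proof.
pose U : comUnitRingType := HB.pack B
  (GRing.ComNzRing_hasMulInverse.Build B mulVB unitB_def invB_out).
pose D : idomainType := HB.pack U (GRing.ComUnitRing_isIntegral.Build U mulf_eq0B).
exists {fraction D}; exists (@FracField.tofrac D : {rmorphism D -> {fraction D}}).
split=> [x|z]; first exact: tofrac_eq0.
by have [x [y [y0 ->]]] := @fractionE D z; exists x, y.
Qed.

End ClassicalInverse.

Section QuotientField.
Variables (S : comNzRingType) (P : set S).
Hypothesis primeP : prime_cone P.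

Let prP : preordering P. Proof. by case: primeP. Qed.
Let PD x y : P x -> P y -> P (x + y). Proof. by case: prP => h _ _; exact: h. Qed.
Let PM x y : P x -> P y -> P (x * y). Proof. by case: prP => _ h _; exact: h. Qed.
Let PX x : P (x ^+ 2). Proof. by case: prP => _ _; apply. Qed.
Let Ptotal x : P x \/ P (- x). Proof. by case: primeP. Qed.

Let cone_support : {pred S} := fun x => `[< P x /\ P (- x) >].

Let supportP x : reflect (P x /\ P (- x)) (x \in cone_support).
Proof. exact: asboolP. Qed.

Let support_idealr : idealr_closed cone_support.
Proof.
split; first by apply/supportP; rewrite oppr0; split; exact: preordering0.
  by apply/supportP => -[_]; case: primeP.
move=> a x y /supportP[Px PNx] /supportP[Py PNy]; apply/supportP.
rewrite opprD; case: (Ptotal a) => Pa; split; apply: PD => //.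
- exact: PM.
- by rewrite -mulrN; exact: PM.
- by rewrite -mulrNN; exact: PM.
- by rewrite -mulNr; exact: PM.
Qed.

Let support_prime : prime_idealr_closed cone_support.
Proof.
move=> x y /supportP[Pxy PNxy]; case: primeP => _ _ _ /(_ x y Pxy PNxy) H.
by apply/orP; case: H => ?; [left|right]; apply/supportP.
Qed.

Let I : prime_idealr S := HB.pack cone_support
  (isIdealr.Build S cone_support support_idealr)
  (isPrimeIdealrClosed.Build S cone_support support_prime).

Lemma quotient_field : exists (F : fieldType) (f : {rmorphism S -> F}),
  (forall x, (f x == 0) = `[< P x /\ P (- x) >]) /\
  (forall z, exists x y, f y != 0 /\ z = f x / f y).
Proof.
have [F [f [f0 fE]]] :=
  @fraction_field {ideal_quot I} (@Quotient.rquot_IdomainAxiom S I).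
pose q : {rmorphism S -> {ideal_quot I}} := (\pi_{ideal_quot I})%qT.
have q_surj u : exists x, u = q x by exists (repr u); apply: esym; exact: reprK.
exists F, (f \o q); split=> [x|z].
  rewrite /= f0 -(rmorph0 q).
  by have := @Quotient.idealrBE S I x 0; rewrite subr0 => {1}<-.
have [u [v [v0 ->]]] := fE z.
have [x ux] := q_surj u; have [y vy] := q_surj v.
by exists x, y; rewrite /= -ux -vy f0.
Qed.

(** The fraction [x / y] equals [x * y / y ^+ 2], so its sign has to be that of [x * y]; this is how
    [Q] orders the quotient field. *)
Lemma ordered_field_of_prime_cone :
  exists (K : realFieldType) (f : {rmorphism S -> K}),
  (forall x, (0 <= f x) = `[< P x >]) /\
  (forall z, exists x y, f y != 0 /\ z = f x / f y).
Proof.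
have [F [f [f0 fE]]] := quotient_field.
pose Q (z : F) := exists x y, [/\ f y != 0, P (x * y) & z = f x / f y].
have P_congr x y : f x = f y -> P x -> P y.
  move=> fxy Px; have /eqP : f (y - x) = 0 by rewrite rmorphB fxy subrr.
  by rewrite f0 => /asboolP[Pyx _]; rewrite -(subrK x y); exact: PD.
have supp z : P z -> P (- z) -> f z = 0.
  by move=> Pz PNz; apply/eqP; rewrite f0; apply/asboolP.
have Qf x : `[< Q (f x) >] = `[< P x >].
  apply/asboolP/asboolP=> [[u [v [v0 Puv E]]]|Px]; last first.
    by exists x, 1; rewrite rmorph1 oner_neq0 mulr1 divr1.
  case: (Ptotal x) => // PNx.
  suff /eqP : f x = 0 by rewrite f0 => /asboolP[].
  (* [x * v ^+ 2] has the same image as [u * v], which is in [P], while its opposite is in [P]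
     because [- x] is. So it lies in the support, and [f x] vanishes. *)
  have fxv : f (x * v ^+ 2) = f (u * v).
    by rewrite expr2 !rmorphM E mulrA divfK.
  have : f (x * v ^+ 2) = 0.
    apply: supp; first exact: P_congr Puv.
    by rewrite -mulNr; apply: PM.
  by move/eqP; rewrite expr2 !rmorphM !mulf_eq0 (negPf v0) !orbF => /eqP.
have [||||K [g [gQ gE]]] := @ordered_field_of_cone F Q.
- move=> _ _ [x [y [y0 Pxy ->]]] [u [v [v0 Puv ->]]].
  exists (x * v + u * y), (y * v); split.
  + by rewrite rmorphM mulf_neq0.
  + have -> : (x * v + u * y) * (y * v) = (x * y) * v ^+ 2 + (u * v) * y ^+ 2 by ring.
    by apply: PD; apply: PM.
  + by rewrite !rmorphM rmorphD !rmorphM addf_div.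
- move=> _ _ [x [y [y0 Pxy ->]]] [u [v [v0 Puv ->]]].
  exists (x * u), (y * v); split.
  + by rewrite rmorphM mulf_neq0.
  + by rewrite mulrACA; apply: PM.
  + by rewrite !rmorphM mulf_div.
- move=> z Qz QNz; have [x [y [y0 zE]]] := fE z.
  (* Multiplying [z] by the square of its denominator gives the image of an element of [S], to which
     [Qf] applies; the same is done for [- z]. *)
  have {Qz} : Q (f (x * y)).
    have -> : f (x * y) = z * f y ^+ 2 by rewrite zE rmorphM expr2 mulrA divfK.
    move: Qz => [u [v [v0 Puv ->]]]; exists (u * y ^+ 2), v; split => //.
      by rewrite mulrAC; apply: PM.
    by rewrite expr2 !rmorphM mulrAC.
  have {QNz} : Q (f (- (x * y))).
    have -> : f (- (x * y)) = - z * f y ^+ 2.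
      by rewrite zE rmorphN rmorphM mulNr expr2 mulrA divfK.
    move: QNz => [u [v [v0 Puv ->]]]; exists (u * y ^+ 2), v; split => //.
      by rewrite mulrAC; apply: PM.
    by rewrite expr2 !rmorphM mulrAC.
  move=> /asboolP; rewrite Qf => /asboolP PNxy /asboolP; rewrite Qf => /asboolP Pxy.
  have /eqP := supp _ Pxy PNxy; rewrite rmorphM mulf_eq0 (negPf y0) orbF => /eqP fx0.
  by rewrite zE fx0 mul0r.
- move=> z; have [x [y [y0 ->]]] := fE z.
  case: (Ptotal (x * y)) => Pxy; [left; exists x, y | right; exists (- x), y].
    by split.
  by rewrite mulNr rmorphN mulNr.
exists K, (g \o f); split=> [x|z]; first by rewrite /= gQ Qf.
have [w ->] := gE z; have [x [y [y0 ->]]] := fE w.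
by exists x, y; rewrite /= fmorph_eq0 y0 fmorph_div.
Qed.

End QuotientField.

(** The description of [K] by fractions is kept because it later shows that the limit field has no
    elements beyond the images of threads. *)
Lemma ordered_field_of_preordering (S : comNzRingType) (T : set S) :
  preordering T -> ~ T (- 1) ->
  exists (K : realFieldType) (f : {rmorphism S -> K}),
  (forall x, T x -> 0 <= f x) /\
  (forall z, exists x y, f y != 0 /\ z = f x / f y).
Proof.
move=> prT T1; have [P primeP TP] := prime_cone_of_preordering prT T1.
have [K [f [fP fE]]] := ordered_field_of_prime_cone primeP.
by exists K, f; split=> // x Tx; rewrite fP; apply/asboolP/TP.
Qed.

(** * Real closure of an ordered field *)

Section WeightedSquares.
Variable K : realFieldType.
Implicit Types (p q g h : {poly K}) (a b c : K).

(** Weights are needed since a nonnegative element of [K] need not be a sum of squares in [K]. *)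
Inductive weighted_sos : {poly K} -> Prop :=
| weighted_sos0 : weighted_sos 0
| weighted_sos_add c g q :
    0 <= c -> weighted_sos q -> weighted_sos (c *: g ^+ 2 + q).

Lemma weighted_sosD p q : weighted_sos p -> weighted_sos q -> weighted_sos (p + q).
Proof.
move=> sp sq; elim: sp => [|c g r c0 _ IH]; first by rewrite add0r.
by rewrite -addrA; exact: weighted_sos_add.
Qed.

Lemma weighted_sosZX c g : 0 <= c -> weighted_sos (c *: g ^+ 2).
Proof. by move=> c0; rewrite -[_ *: _]addr0; apply: weighted_sos_add => //; exact: weighted_sos0. Qed.

Lemma weighted_sosX g : weighted_sos (g ^+ 2).
Proof. by rewrite -[_ ^+ 2]scale1r; exact: weighted_sosZX. Qed.

Lemma weighted_sosC c : 0 <= c -> weighted_sos c%:P.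
Proof. by move=> c0; rewrite -[c%:P]mulr1 mul_polyC -(expr1n _ 2); exact: weighted_sosZX. Qed.

Lemma weighted_sosM p q : weighted_sos p -> weighted_sos q -> weighted_sos (p * q).
Proof.
move=> sp sq; elim: sp => [|c g r c0 _ IH]; first by rewrite mul0r; exact: weighted_sos0.
rewrite mulrDl; apply: weighted_sosD => //.
elim: sq => [|d h s d0 _ IH']; first by rewrite mulr0; exact: weighted_sos0.
rewrite mulrDr; apply: weighted_sosD => //.
by rewrite -scalerAl -scalerAr scalerA -exprMn; apply: weighted_sosZX; exact: mulr_ge0.
Qed.

Lemma weighted_sos_ge0 (L : realFieldType) (f : {rmorphism K -> L}) q x :
  {homo f : u v / u <= v} -> weighted_sos q -> 0 <= (map_poly f q).[x].
Proof.
move=> fle; elim=> [|c g r c0 _ IH]; first by rewrite rmorph0 horner0.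
rewrite rmorphD hornerD; apply: addr_ge0 => //.
rewrite -mul_polyC rmorphM rmorphXn /= hornerM map_polyC hornerC horner_exp mulr_ge0 ?sqr_ge0 //.
by rewrite -(rmorph0 f); exact: fle.
Qed.

Lemma weighted_sos_horner_ge0 q x : weighted_sos q -> 0 <= q.[x].
Proof.
by move=> sq; have := @weighted_sos_ge0 K idfun q x (fun _ _ => id) sq; rewrite map_poly_id.
Qed.

(** Every [g] under a square is replaced by its remainder modulo [p], so the degree of the result is
    at most [2 deg p - 2]. *)
Lemma weighted_sos_modp p q : (1 < size p)%N -> weighted_sos q ->
  exists r h, [/\ weighted_sos r, (size r < (size p).-1.*2)%N & q = r + p * h].
Proof.
move=> p1; elim=> [|c g r c0 _ [s [h [sS szs ->]]]].
  exists 0, 0; split; first exact: weighted_sos0.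
    by rewrite size_poly0 double_gt0 -ltnS prednK // ltnW.
  by rewrite mulr0 addr0.
pose t := g %% p; pose e := g %/ p.
have szt : (size t < size p)%N by rewrite ltn_modpN0 // -size_poly_gt0 ltnW.
exists (c *: t ^+ 2 + s), (c *: (e * (e * p + t *+ 2)) + h); split.
- exact: weighted_sos_add.
- apply: leq_ltn_trans (size_polyD _ _) _; rewrite gtn_max szs andbT.
  apply: leq_ltn_trans (size_scale_leq _ _) _.
  rewrite expr2; apply: leq_ltn_trans (size_polyMleq _ _) _.
  move: szt p1; move: (size t) (size p) => i j; lia.
- have -> : g = e * p + t by exact: divp_eq.
  rewrite -!mul_polyC; ring.
Qed.

End WeightedSquares.

Record ordered_extension (K : realFieldType) := OrderedExtension {
  ext_field :> realFieldType;
  ext_map : {rmorphism K -> ext_field};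
  ext_homo : {homo ext_map : u v / u <= v}
}.

Definition trivial_extension (K : realFieldType) : ordered_extension K :=
  @OrderedExtension K K idfun (fun _ _ => id).

Definition has_root_in (K : realFieldType) (E : ordered_extension K)
    (p : {poly K}) (a b : K) :=
  exists2 x : E, ext_map E a <= x <= ext_map E b & root (map_poly (ext_map E) p) x.

(* A certificate [-1 = s0 + (X - a) s1 + (b - X) s2 + p h], with the
   [si] reduced modulo [p], forces [deg h < deg p] and makes [h] change sign on
   [[a, b]]; a root of [h] in an ordered extension then contradicts it. *)
Lemma root_extension n (K : realFieldType) (p : {poly K}) (a b : K) :
  (size p <= n)%N -> a <= b -> p.[a] <= 0 <= p.[b] ->
  exists E : ordered_extension K, has_root_in E p a b.
Proof.
elim: n K p a b => [|n IHn] K p a b szp leab /andP[pa pb].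
  exists (trivial_extension K), a; first by rewrite /= lexx leab.
  by move: szp; rewrite map_poly_id // size_poly_leq0 => /eqP ->; exact: root0.
have [pa0|pa0] := eqVneq p.[a] 0.
  by exists (trivial_extension K), a; rewrite /= ?lexx ?leab // map_poly_id //; apply/rootP.
have [pb0|pb0] := eqVneq p.[b] 0.
  by exists (trivial_extension K), b; rewrite /= ?lexx ?leab // map_poly_id //; apply/rootP.
have {pa0}pa : p.[a] < 0 by rewrite lt_neqAle pa0.
have {pb0}pb : 0 < p.[b] by rewrite lt_neqAle eq_sym pb0.
have ltab : a < b by rewrite lt_neqAle leab andbT; apply: contraTneq pa => ->; rewrite -leNgt ltW.
have p1 : (1 < size p)%N.
  rewrite ltnNge; apply/negP => /size1_polyC pE; move: pa pb; rewrite pE !hornerC => /lt_trans h /h.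
  by rewrite ltxx.
pose U : {poly K} := 'X - a%:P; pose V : {poly K} := b%:P - 'X.
pose T : set {poly K} := fun q => exists s0 s1 s2 h,
  [/\ weighted_sos s0, weighted_sos s1, weighted_sos s2 & q = s0 + U * s1 + V * s2 + p * h].
have Tsos q : weighted_sos q -> T q.
  by move=> sq; exists q, 0, 0, 0; split=> //; rewrite ?mulr0 ?addr0 //; exact: weighted_sos0.
have prT : preordering T.
  split=> [||q]; last by apply: Tsos; exact: weighted_sosX.
  - move=> _ _ [s0 [s1 [s2 [h [S0 S1 S2 ->]]]]] [t0 [t1 [t2 [k [T0 T1 T2 ->]]]]].
    exists (s0 + t0), (s1 + t1), (s2 + t2), (h + k); split; try exact: weighted_sosD.
    by ring.
  - move=> _ _ [s0 [s1 [s2 [h [S0 S1 S2 ->]]]]] [t0 [t1 [t2 [k [T0 T1 T2 ->]]]]].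
    pose G : {poly K} := ((b - a)^-1)%:P.
    have SG : weighted_sos G by apply: weighted_sosC; rewrite invr_ge0 subr_ge0.
    have GUV : G * (U + V) = 1.
      by rewrite /U /V addrC subrKA -polyCB -polyCM mulVf // subr_eq0 gt_eqF.
    (* Since [U + V] is the constant [b - a], the product [U * V] is a combination of [U * V ^+ 2]
       and [V * U ^+ 2] with a positive weight. This is why the elements of [T] have no separate
       term in [U * V]. *)
    have UVE : U * V = G * (U * V * (U + V)).
      by rewrite mulrCA GUV mulr1.
    have SM := @weighted_sosM K; have SX := @weighted_sosX K.
    exists (s0 * t0 + U ^+ 2 * (s1 * t1) + V ^+ 2 * (s2 * t2)),
      (s0 * t1 + s1 * t0 + G * V ^+ 2 * (s1 * t2 + s2 * t1)),
      (s0 * t2 + s2 * t0 + G * U ^+ 2 * (s1 * t2 + s2 * t1)),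
      (h * (t0 + U * t1 + V * t2) + k * (s0 + U * s1 + V * s2) + p * h * k).
    split; try by do ?[apply: weighted_sosD | exact: (SX) | apply: (SM)].
    have -> : (s0 + U * s1 + V * s2 + p * h) * (t0 + U * t1 + V * t2 + p * k)
      = s0 * t0 + U ^+ 2 * (s1 * t1) + V ^+ 2 * (s2 * t2) +
        U * (s0 * t1 + s1 * t0) + V * (s0 * t2 + s2 * t0) + U * V * (s1 * t2 + s2 * t1) +
       p * (h * (t0 + U * t1 + V * t2) + k * (s0 + U * s1 + V * s2) + p * h * k) by ring.
    by rewrite UVE; ring.
have T1 : ~ T (- 1).
  move=> [s0' [s1' [s2' [h' [S0' S1' S2' E]]]]].
  have [s0 [h0 [S0 z0 E0]]] := weighted_sos_modp p1 S0'.
  have [s1 [h1 [S1 z1 E1]]] := weighted_sos_modp p1 S1'.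
  have [s2 [h2 [S2 z2 E2]]] := weighted_sos_modp p1 S2'.
  pose h := h0 + U * h1 + V * h2 + h'.
  have {}E : - 1 = s0 + U * s1 + V * s2 + p * h by rewrite E E0 E1 E2 /h; ring.
  (* At [a] the factor [U] vanishes and [V] is positive, so the certificate leaves [p.[a] * h.[a] <=
     - 1]; the situation at [b] is symmetric. *)
  have pa_h : p.[a] * h.[a] < 0.
    have := congr1 (horner^~ a) E; rewrite !hornerE /= subrr mul0r addr0 => Ea.
    have := weighted_sos_horner_ge0 a S0; have := weighted_sos_horner_ge0 a S2.
    move: Ea; nra.
  have pb_h : p.[b] * h.[b] < 0.
    have := congr1 (horner^~ b) E; rewrite !hornerE /= subrr mul0r addr0 => Ea.
    have := weighted_sos_horner_ge0 b S0; have := weighted_sos_horner_ge0 b S1.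
    move: Ea; nra.
  have h0n : h != 0 by apply: contraTneq pa_h => ->; rewrite horner0 mulr0 ltxx.
  (* The reduced certificate bounds the degree of [p * h] by [2 deg p - 1], hence that of [h] by
     [deg p - 1], which lets the induction on [n] apply to [h]. *)
  have szh : (size h <= n)%N.
    have : (size (p * h)%R <= (size p).-1.*2)%N.
      have -> : p * h = - 1 - (s0 + U * s1 + V * s2) by rewrite E; ring.
      have szU : (size U <= 2)%N by rewrite /U size_XsubC.
      have szV : (size V <= 2)%N by rewrite /V -opprB size_polyN size_XsubC.
      have Us1 : (size (U * s1)%R <= (size p).-1.*2)%N.
        by apply: leq_trans (size_polyMleq _ _) _; move: szU z1; clear; lia.
      have Vs2 : (size (V * s2)%R <= (size p).-1.*2)%N.
        by apply: leq_trans (size_polyMleq _ _) _; move: szV z2; clear; lia.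
      apply: leq_trans (size_polyD _ _) _; rewrite !size_polyN size_poly1 geq_max.
      apply/andP; split; first by move: p1; clear; lia.
      apply: leq_trans (size_polyD _ _) _; rewrite geq_max Vs2 andbT.
      by apply: leq_trans (size_polyD _ _) _; rewrite geq_max Us1 (ltnW z0).
    have pn0 : p != 0 by rewrite -size_poly_gt0 ltnW.
    rewrite size_mul //; move: szp p1 h0n; rewrite -size_poly_gt0.
    move: (size p) (size h); clear; lia.
  (* [h] has the opposite sign to [p] at both ends, so it is [- h] that goes from nonpositive to
     nonnegative. *)
  have [||[L f fle] [x /= /andP[ax xb] /rootP hx]] := IHn K (- h) a b _ leab.
  - by rewrite size_polyN.
  - rewrite !hornerN oppr_le0 oppr_ge0; apply/andP; split; nra.
  have := congr1 (fun q => (map_poly f q).[x]) E.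
  rewrite /= !rmorphD !rmorphM !rmorphN /= rmorph1 /U /V !rmorphB /= !map_polyX !map_polyC.
  rewrite !hornerE /=.
  move: hx; rewrite rmorphN hornerN => /eqP; rewrite oppr_eq0 => /eqP ->.
  have := weighted_sos_ge0 x fle S0; have := weighted_sos_ge0 x fle S1.
  have := weighted_sos_ge0 x fle S2.
  nra.
have [L [F [FT _]]] := ordered_field_of_preordering prT T1.
(* Both [p] and [- p] are in [T]. The image of ['X] is therefore the root sought, and [U] and [V] in
   [T] place it between [a] and [b]. *)
have Fp : F p = 0.
  apply/eqP; rewrite eq_le -oppr_ge0 -rmorphN; apply/andP; split; apply: FT.
    by exists 0, 0, 0, (- 1); split; try exact: weighted_sos0; rewrite !mulr0 !add0r mulrN1.
  by exists 0, 0, 0, 1; split; try exact: weighted_sos0; rewrite !mulr0 !add0r mulr1.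
have homoF : {homo F \o polyC : u v / u <= v}.
  move=> u v uv /=; rewrite -subr_ge0 -rmorphB -polyCB; apply: FT; apply: Tsos.
  by apply: weighted_sosC; rewrite subr_ge0.
exists (OrderedExtension homoF), (F 'X) => /=.
- rewrite /= -subr_ge0 -rmorphB -[_ <= F b%:P]subr_ge0 -[F b%:P - _]rmorphB.
  have S1 : weighted_sos (1 : {poly K}) by rewrite -(expr1n _ 2); exact: weighted_sosX.
  apply/andP; split; apply: FT.
    by exists 0, 1, 0, 0; split; try exact: weighted_sos0; rewrite // !mulr0 !addr0 add0r mulr1.
  by exists 0, 0, 1, 0; split; try exact: weighted_sos0; rewrite // !mulr0 !addr0 add0r mulr1.
- by apply/rootP; rewrite map_poly_comp horner_map -/(p \Po 'X) comp_polyXr.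
Qed.

(* [i0] makes the index type inhabited, so that [1 != 0]. *)
Definition product_ring (I : Type) (i0 : I) (R : I -> comNzRingType) := forall i, R i.

Section ProductRing.
Variables (I : Type) (i0 : I) (R : I -> comNzRingType).
Local Notation S := (product_ring i0 R).
Implicit Types x y z : S.

HB.instance Definition _ := Choice.copy S (forall i, R i).

Let add x y : S := fun i => x i + y i.
Let opp x : S := fun i => - x i.
Let mul x y : S := fun i => x i * y i.
Let zero : S := fun=> 0.
Let one : S := fun=> 1.

Let addA : associative add.
Proof. by move=> x y z; apply: functional_extensionality_dep => i; exact: addrA. Qed.
Let addC : commutative add.
Proof. by move=> x y; apply: functional_extensionality_dep => i; exact: addrC. Qed.
Let add0 : left_id zero add.
Proof. by move=> x; apply: functional_extensionality_dep => i; exact: add0r. Qed.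
Let addN : left_inverse zero opp add.
Proof. by move=> x; apply: functional_extensionality_dep => i; exact: addNr. Qed.
HB.instance Definition _ := GRing.isZmodule.Build S addA addC add0 addN.

Let mulA : associative mul.
Proof. by move=> x y z; apply: functional_extensionality_dep => i; exact: mulrA. Qed.
Let mulC : commutative mul.
Proof. by move=> x y; apply: functional_extensionality_dep => i; exact: mulrC. Qed.
Let mul1 : left_id one mul.
Proof. by move=> x; apply: functional_extensionality_dep => i; exact: mul1r. Qed.
Let mulDl : left_distributive mul add.
Proof. by move=> x y z; apply: functional_extensionality_dep => i; exact: mulrDl. Qed.
Let one_neq0 : one != zero.
Proof. by apply/eqP => /(congr1 (fun x : S => x i0)) /eqP; rewrite oner_eq0. Qed.
HB.instance Definition _ := GRing.Zmodule_isComNzRing.Build S mulA mulC mul1 mulDl one_neq0.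

Definition proj i (x : S) : R i := x i.
Let proj_additive i : zmod_morphism (proj i). Proof. by []. Qed.
Let proj_monoid i : monoid_morphism (proj i). Proof. by []. Qed.
HB.instance Definition _ i := GRing.isZmodMorphism.Build S (R i) (proj i) (proj_additive i).
HB.instance Definition _ i := GRing.isMonoidMorphism.Build S (R i) (proj i) (proj_monoid i).

Section Pairing.
Variables (A : comNzRingType) (f : forall i, {rmorphism A -> R i}).
Definition pairing (a : A) : S := fun i => f i a.
Let pairing_additive : zmod_morphism pairing.
Proof. by move=> a b; apply: functional_extensionality_dep => i; exact: rmorphB. Qed.
Let pairing_monoid : monoid_morphism pairing.
Proof.
split=> [|a b]; apply: functional_extensionality_dep => i; first exact: rmorph1.
exact: rmorphM.
Qed.
HB.instance Definition _ := GRing.isZmodMorphism.Build A S pairing pairing_additive.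
HB.instance Definition _ := GRing.isMonoidMorphism.Build A S pairing pairing_monoid.
End Pairing.

End ProductRing.

(** * Limits of ordered fields along a directed relation *)

Definition eventually (I : Type) (R : I -> I -> Prop) (P : I -> Prop) :=
  exists i, forall j, R i j -> P j.

(** The eventually nonnegative elements form a proper preordering. An ordered field above it does
    the work of an ultrafilter: whatever holds eventually survives in [L]. *)
Lemma germ_field (I : Type) (i0 : I) (R : I -> I -> Prop) (K : I -> realFieldType)
    (S : comNzRingType) (ev : forall i, {rmorphism S -> K i}) :
  (forall i, exists j, R i j) ->
  (forall i j, exists k, forall l, R k l -> R i l /\ R j l) ->
  exists (L : realFieldType) (f : {rmorphism S -> L}),
  (forall x, eventually R (fun i => 0 <= ev i x) -> 0 <= f x) /\
  (forall z, exists x y, f y != 0 /\ z = f x / f y).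
Proof.
move=> Rex Rdir; apply: ordered_field_of_preordering => [|[i]]; last first.
  by have [j Rij] := Rex i; move=> /(_ j Rij); rewrite rmorphN rmorph1 oppr_ge0 ler10.
split=> [x y [i xi] [j yj]|x y [i xi] [j yj]|x].
- have [k Rk] := Rdir i j; exists k => l /Rk[il jl].
  by rewrite rmorphD addr_ge0 ?xi ?yj.
- have [k Rk] := Rdir i j; exists k => l /Rk[il jl].
  by rewrite rmorphM mulr_ge0 ?xi ?yj.
- by exists i0 => j _; rewrite rmorphXn sqr_ge0.
Qed.

Lemma ext_root (K : realFieldType) (E : ordered_extension K) p x :
  root p x -> root (map_poly (ext_map E) p) (ext_map E x).
Proof. by move=> /rootP px; apply/rootP; rewrite horner_map px rmorph0. Qed.

Definition ext_comp (K : realFieldType) (E : ordered_extension K)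
    (G : ordered_extension E) : ordered_extension K :=
  @OrderedExtension K G (ext_map G \o ext_map E)
    (fun u v uv => @ext_homo _ G _ _ (@ext_homo _ E _ _ uv)).

Definition solvable_in (K : realFieldType) (E : ordered_extension K)
    (t : {poly K} * (K * K)) :=
  t.2.1 <= t.2.2 -> t.1.[t.2.1] <= 0 <= t.1.[t.2.2] ->
  has_root_in E t.1 t.2.1 t.2.2.

(** Roots are adjoined one at a time; monotone maps and [ext_root] carry the roots already found,
    with their bounds, into the next extension. *)
Lemma solve_seq (K : realFieldType) (s : seq ({poly K} * (K * K))) :
  exists E : ordered_extension K, forall t, t \in s -> solvable_in E t.
Proof.
elim: s => [|[p [a b]] s [E IH]]; first by exists (trivial_extension K).
have [[leab pab]|nab] := pselect (a <= b /\ p.[a] <= 0 <= p.[b]); last first.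
  exists E => t; rewrite inE => /predU1P[->|/IH//] leab pab.
  by case: nab.
have [||G [x abx px]] :=
    @root_extension _ E (map_poly (ext_map E) p) (ext_map E a) (ext_map E b) (leqnn _).
- exact: ext_homo.
- by rewrite !horner_map -(rmorph0 (ext_map E)); case/andP: pab => pa pb; rewrite !ext_homo.
exists (ext_comp G) => t; rewrite inE => /predU1P[->_ _|/IH{}IH t1 t2] /=.
  by exists x => //=; rewrite map_poly_comp.
have [y /andP[ay yb] py] := IH t1 t2; exists (ext_map G y).
  by rewrite /= !ext_homo.
by rewrite /= map_poly_comp; exact: ext_root.
Qed.

(** The fields of [solve_seq] are indexed by finite lists of problems ordered by inclusion. Each
    problem belongs to all lists from some point on, so its solution passes to the limit given by
    [germ_field]. *)
Lemma solve_all (K : realFieldType) :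
  exists E : ordered_extension K, forall t, solvable_in E t.
Proof.
have [E EP] := choice (@solve_seq K).
pose S := product_ring [::] (fun s => E s).
pose R (s s' : seq ({poly K} * (K * K))) : Prop := {subset s <= s'}.
have [||L [f [fR _]]] := @germ_field _ [::] R (fun s => E s) S (@proj _ [::] (fun s => E s)).
- by move=> s; exists s.
- by move=> s s'; exists (s ++ s') => l sl; split=> x xs; apply: sl; rewrite mem_cat xs ?orbT.
have f_eq0 x : eventually R (fun s => x s = 0) -> f x = 0.
  move=> [s xs]; apply/eqP; rewrite eq_le -oppr_ge0 -rmorphN.
  by apply/andP; split; apply: fR; exists s => s' /xs; rewrite ?rmorphN /= /proj => ->; rewrite ?oppr0.
pose c : K -> S := @pairing _ [::] _ K (fun s => ext_map (E s)).
have homo_fc : {homo f \o c : u v / u <= v}.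
  move=> u v uv; rewrite /= -subr_ge0 -rmorphB; apply: fR; exists [::] => s _.
  by rewrite rmorphB /proj subr_ge0; apply: ext_homo.
exists (OrderedExtension homo_fc) => -[p [a b]] /= leab pab.
(* On a list without the given problem the coordinate is [0]; only the lists that contain the
   problem matter in the limit. *)
have sol s : exists x : E s, (p, (a, b)) \in s ->
    ext_map (E s) a <= x <= ext_map (E s) b /\ root (map_poly (ext_map (E s)) p) x.
  have [/EP h|] := boolP ((p, (a, b)) \in s); last by exists 0.
  by have [x abx px] := h leab pab; exists x.
pose x : S := fun s => projT1 (cid (sol s)).
have xP s : (p, (a, b)) \in s ->
    ext_map (E s) a <= x s <= ext_map (E s) b /\ root (map_poly (ext_map (E s)) p) (x s).
  exact: (projT2 (cid (sol s))).
exists (f x).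
  rewrite /= -subr_ge0 -rmorphB -[_ <= f (c b)]subr_ge0 -[f (c b) - _]rmorphB.
  apply/andP; split; apply: fR; exists [:: (p, (a, b))] => s /(_ _ (mem_head _ _)) /xP.
    by rewrite rmorphB /proj subr_ge0 => -[/andP[]].
  by rewrite rmorphB /proj subr_ge0 => -[/andP[]].
apply/rootP; rewrite map_poly_comp horner_map; apply: f_eq0.
exists [:: (p, (a, b))] => s /(_ _ (mem_head _ _)) /xP[_ /rootP px].
rewrite -[LHS]/(proj s _) -horner_map -map_poly_comp.
exact: px.
Qed.

Section Threads.
Variables (K : nat -> comNzRingType) (step : forall n, {rmorphism K n -> K n.+1}).
Let S := product_ring 0%N K.

(** Up to eventual equality these sequences are the elements of the direct limit of the [K n];
    requiring coherence only eventually allows an element to start at any level. *)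
Definition coherent : {pred S} :=
  fun x => `[< eventually leq (fun n => x n.+1 = step n (x n)) >].

Let coherentP (x : S) :
  reflect (eventually leq (fun n => x n.+1 = step n (x n))) (x \in coherent).
Proof. exact: asboolP. Qed.

Let coherent_subring : subring_closed coherent.
Proof.
split; first by apply/coherentP; exists 0%N => n _; rewrite rmorph1.
  move=> x y /coherentP[i xi] /coherentP[j yj]; apply/coherentP.
  exists (maxn i j) => n; rewrite geq_max => /andP[/xi xn /yj yn].
  by rewrite rmorphB -xn -yn.
move=> x y /coherentP[i xi] /coherentP[j yj]; apply/coherentP.
exists (maxn i j) => n; rewrite geq_max => /andP[/xi xn /yj yn].
by rewrite rmorphM -xn -yn.
Qed.
HB.instance Definition _ := GRing.isSubringClosed.Build S coherent coherent_subring.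

Record thread := Thread { thread_seq :> S; _ : thread_seq \in coherent }.
HB.instance Definition _ := [isSub for thread_seq].
HB.instance Definition _ := [Choice of thread by <:].
HB.instance Definition _ := [SubChoice_isSubComNzRing of thread by <:].

Lemma thread_ring : exists (T : comNzRingType) (ev : forall n, {rmorphism T -> K n}),
  (forall t, eventually leq (fun n => ev n.+1 t = step n (ev n t))) /\
  (forall x : forall n, K n, eventually leq (fun n => x n.+1 = step n (x n)) ->
     exists t, forall n, ev n t = x n).
Proof.
exists thread, (fun n => @proj _ 0%N K n \o (\val : {rmorphism thread -> S})).
split=> [[t /= /coherentP]//|x /coherentP cx]; by exists (Thread cx).
Qed.

End Threads.

Lemma eventually_leq_ind (N : nat) (P : nat -> Prop) : P N ->
  (forall n, (N <= n)%N -> P n -> P n.+1) -> forall n, (N <= n)%N -> P n.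
Proof.
move=> PN PS; elim=> [|n IHn]; first by rewrite leqn0 => /eqP <-.
by rewrite leq_eqVlt => /predU1P[<-//|Nn]; apply: PS => //; exact: IHn.
Qed.

(** The induction on [N] shifts the family [T], which avoids casts between dependent types; [d]
    fills in the irrelevant values below [N]. *)
Lemma sequence_through (T : nat -> Type) (s : forall n, T n -> T n.+1) (d : T 0%N)
    N (y : T N) :
  exists x : forall n, T n, x N = y /\ forall n, (N <= n)%N -> x n.+1 = s n (x n).
Proof.
elim: N T s d y => [|N IHN] T s d y; first by exists (nat_rect T y s).
have [x [xN xS]] := IHN (fun n => T n.+1) (fun n => s n.+1) (s 0%N d) y.
by exists (fun n => if n is m.+1 then x m else d); split=> // -[//|n] /xS.
Qed.

Section Limit.
Variable K : realFieldType.

Let next (L : realFieldType) : ordered_extension L := projT1 (cid (solve_all L)).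
Let nextP L t : solvable_in (next L) t.
Proof. exact: (projT2 (cid (solve_all L))). Qed.

Fixpoint tower n : realFieldType := if n is m.+1 then next (tower m) else K.
Let step n : {rmorphism tower n -> tower n.+1} := ext_map (next (tower n)).
Let step_homo n : {homo @step n : u v / u <= v}. Proof. exact: ext_homo. Qed.

Fixpoint tower_base n : {rmorphism K -> tower n} :=
  if n is m.+1 then step m \o tower_base m else idfun.

(** Each level of [tower] contains the roots demanded by all sign changes over the level before. A
    polynomial over the limit, together with an interval, already lives on some level and gets its
    root on the next one. *)
Lemma real_closure :
  exists (L : rcfType) (f : {rmorphism K -> L}), {homo f : u v / u <= v}.
Proof.
have [T [ev [thread_coherent threadE]]] := @thread_ring (fun n => tower n) step.
have [||L [f [fge0 fE]]] := @germ_field _ 0%N leq (fun n => tower n) T ev.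
- by move=> n; exists n.
- by move=> i j; exists (maxn i j) => l; rewrite geq_max => /andP.
have f_le x y : eventually leq (fun n => ev n x <= ev n y) -> f x <= f y.
  move=> [N xy]; rewrite -subr_ge0 -rmorphB; apply: fge0.
  by exists N => n /xy; rewrite rmorphB subr_ge0.
have f_eq x y : eventually leq (fun n => ev n x = ev n y) -> f x = f y.
  by move=> [N xy]; apply/le_anti/andP; split; apply: f_le; exists N => n /xy ->.
(* Field morphisms are injective, so a thread is either eventually zero or eventually nonzero; in
   the second case its pointwise inverse is a thread too. *)
have inverse x : eventually leq (fun n => ev n x = 0) \/ exists y, f x * f y = 1.
  have [N xN] := thread_coherent x.
  have [/eqP x0|x0] := boolP (ev N x == 0).
    left; exists N; apply: eventually_leq_ind => // n Nn xn0.
    by rewrite xN // xn0 rmorph0.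
  right; have [|y yE] := @threadE (fun n => (ev n x)^-1 : tower n).
    by exists N => n /xN ->; rewrite fmorphV.
  exists y; rewrite -rmorphM -(rmorph1 f); apply: f_eq.
  exists N; suff xn0 n : (N <= n)%N -> ev n x != 0.
    by move=> n /xn0 h; rewrite rmorphM yE rmorph1 mulfV.
  move: n; apply: eventually_leq_ind => // n Nn xn0.
  by rewrite xN // fmorph_eq0.
(* Inverses of threads being threads, every fraction of images is already an image. *)
have f_surj z : exists x, z = f x.
  have [x [y [y0 ->]]] := fE z.
  have [[N yN]|[w yw]] := inverse y.
  - suff fy0 : f y = f 0 by rewrite fy0 rmorph0 eqxx in y0.
    by apply: f_eq; exists N => n /yN ->; rewrite rmorph0.
  - exists (x * w); rewrite rmorphM; congr (_ * _).
    by rewrite -[f w](mulKf y0) yw mulr1.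
(* The sign of [d] at level [N] persists upwards. If it is negative there, then [f d] is both
   nonnegative and nonpositive, so [d] has no inverse and is eventually zero. *)
have le_f x y : f x <= f y -> eventually leq (fun n => ev n x <= ev n y).
  rewrite -subr_ge0 -rmorphB; set d := y - x => fd.
  suff [N dN] : eventually leq (fun n => 0 <= ev n d).
    by exists N => n /dN; rewrite rmorphB subr_ge0.
  have [N dN] := thread_coherent d.
  have step0 n u : (0 <= u -> 0 <= step n u) /\ (u <= 0 -> step n u <= 0).
    by split=> /step_homo; rewrite rmorph0.
  have [dN0|/ltW dN0] := leP 0 (ev N d).
    exists N; apply: eventually_leq_ind => // n Nn IHn.
    by rewrite dN //; apply: (step0 _ _).1.
  have [[M dM]|[w dw]] := inverse d; first by exists M => n /dM ->.
  have : f d <= f 0.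
    apply: f_le; exists N; apply: eventually_leq_ind => [|n Nn].
      by rewrite rmorph0.
    by rewrite !rmorph0 dN //; apply: (step0 _ _).2.
  rewrite rmorph0 => fd'; have fd0 : f d = 0 by apply/le_anti/andP.
  by move: dw; rewrite fd0 mul0r => /eqP; rewrite eq_sym oner_eq0.
have poly_surj (p : {poly L}) : exists P : {poly T}, map_poly f P = p.
  elim/poly_ind: p => [|p c [P <-]]; first by exists 0; rewrite rmorph0.
  have [x ->] := f_surj c; exists (P * 'X + x%:P).
  by rewrite rmorphD rmorphM /= map_polyX map_polyC.
have poly_coherent (P : {poly T}) : eventually leq (fun n =>
    map_poly (ev n.+1) P = map_poly (step n) (map_poly (ev n) P)).
  elim/poly_ind: P => [|P c [N PN]]; first by exists 0%N => n _; rewrite !rmorph0.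
  have [M cM] := thread_coherent c; exists (maxn N M) => n.
  rewrite geq_max => /andP[/PN Pn /cM cn].
  by rewrite !rmorphD !rmorphM /= !map_polyX !map_polyC /= Pn cn.
have closedL : Num.real_closed_axiom L.
  move=> p a b leab /andP[pa pb].
  have [P PE] := poly_surj p; have [u ua] := f_surj a; have [v vb] := f_surj b.
  move: leab pa pb; rewrite -PE ua vb !horner_map -(rmorph0 f).
  move=> /le_f[N1 uv] /le_f[N2 Pu] /le_f[N3 Pv].
  have [N4 PN] := poly_coherent P.
  have [N5 uN] := thread_coherent u; have [N6 vN] := thread_coherent v.
  (* From level [N] on, the inequalities hold and the polynomial and both endpoints follow [step].
     The root [x] appears at level [N.+1], where its thread starts. *)
  pose N := maxn N1 (maxn N2 (maxn N3 (maxn N4 (maxn N5 N6)))).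
  have : (N <= N)%N by [].
  rewrite {1}/N !geq_max => /and5P[/uv {}uv /Pu {}Pu /Pv {}Pv N4N /andP[N5N N6N]].
  have [|x] := @nextP _ (map_poly (ev N) P, (ev N u, ev N v)) uv.
    by rewrite /= !horner_map /= -(rmorph0 (ev N)) Pu Pv.
  rewrite /= => /andP[ux xv] Px.
  have [w [wN wS]] := @sequence_through (fun n => tower n) (fun n => step n) 0 N.+1 x.
  have [|y yE] := @threadE w; first by exists N.+1.
  have yN : ev N.+1 y = x by rewrite yE.
  have yS n : (N < n)%N -> ev n.+1 y = step n (ev n y) by rewrite !yE; exact: wS.
  have le_step : forall n, (N < n)%N -> ev n u <= ev n y <= ev n v.
    apply: eventually_leq_ind => [|n Nn /andP[uy yv]].
      by rewrite yN uN // vN // ux xv.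
    have N5n := leq_trans N5N (ltnW Nn); have N6n := leq_trans N6N (ltnW Nn).
    by rewrite yS // uN // vN // !step_homo.
  exists (f y).
    by apply/andP; split; apply: f_le; exists N.+1 => n /le_step /andP[].
  apply/rootP; rewrite horner_map -(rmorph0 f); apply: f_eq.
  exists N.+1; apply: eventually_leq_ind => [|n Nn IHn]; rewrite rmorph0 -horner_map /=.
    by rewrite yN PN //; apply/rootP.
  rewrite yS // PN ?(leq_trans N4N (ltnW Nn)) //.
  by rewrite horner_map /= horner_map IHn /= rmorph0 rmorph0.
pose M : rcfType := HB.pack L (Num.RealField_isClosed.Build L closedL).
have /choice[h hE] (x : K) : exists t : T, forall n, ev n t = tower_base n x.
  by apply: threadE; exists 0%N.
have c_zmod : zmod_morphism (f \o h : K -> M).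
  move=> x y; rewrite /= -rmorphB; apply: f_eq.
  by exists 0%N => n _; rewrite rmorphB !hE rmorphB.
have c_monoid : monoid_morphism (f \o h : K -> M).
  split=> [|x y]; first by rewrite -(rmorph1 f); apply: f_eq; exists 0%N => n _; rewrite hE !rmorph1.
  rewrite /= -rmorphM; apply: f_eq.
  by exists 0%N => n _; rewrite rmorphM !hE rmorphM.
pose c : {rmorphism K -> M} := HB.pack (f \o h : K -> M)
  (GRing.isZmodMorphism.Build K M _ c_zmod) (GRing.isMonoidMorphism.Build K M _ c_monoid).
exists M, c => x y xy; apply: f_le; exists 0%N => n _; rewrite !hE.
by elim: n => // n IHn; exact: step_homo.
Qed.

End Limit.

Lemma real_closed_of_preordering (S : comNzRingType) (T : set S) :
  preordering T -> ~ T (- 1) ->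
  exists (R : rcfType) (f : {rmorphism S -> R}), forall x, T x -> 0 <= f x.
Proof.
move=> prT T1; have [K [f [fT _]]] := ordered_field_of_preordering prT T1.
have [R [g gle]] := real_closure K; exists R, (g \o f) => x /fT.
by rewrite -(rmorph0 g); exact: gle.
Qed.

(** * The Positivstellensatz *)

Definition sos (A : comNzRingType) (x : A) := exists s : seq A, x = \sum_(a <- s) a ^+ 2.

Section SumsOfSquares.
Variable A : comNzRingType.
Implicit Types x y : A.

Lemma sos0 : sos (0 : A).
Proof. by exists [::]; rewrite big_nil. Qed.

Lemma sosX x : sos (x ^+ 2).
Proof. by exists [:: x]; rewrite big_seq1. Qed.

Lemma sos1 : sos (1 : A).
Proof. by rewrite -(expr1n _ 2); exact: sosX. Qed.

Lemma sosD x y : sos x -> sos y -> sos (x + y).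
Proof. by move=> [s ->] [t ->]; exists (s ++ t); rewrite big_cat. Qed.

Lemma sosM x y : sos x -> sos y -> sos (x * y).
Proof.
move=> [s ->] [t ->]; exists [seq a * b | a <- s, b <- t].
rewrite big_allpairs_dep mulr_suml; apply: eq_bigr => a _; rewrite mulr_sumr.
by apply: eq_bigr => b _; rewrite exprMn.
Qed.

(* If no such identity exists, then the sums [s - a t] form a proper preordering. *)
Lemma positivstellensatz (a : A) :
  (forall (R : rcfType) (f : {rmorphism A -> R}), 0 < f a) ->
  exists s t, [/\ sos s, sos t & a * s = 1 + t].
Proof.
move=> a_gt0; apply: contrapT => no.
pose T : set A := fun x => exists s t, [/\ sos s, sos t & x = s - a * t].
have prT : preordering T.
  split=> [||x]; last by exists (x ^+ 2), 0; split; [exact: sosX | exact: sos0 | ring].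
  - move=> _ _ [s [t [Ss St ->]]] [u [v [Su Sv ->]]].
    by exists (s + u), (t + v); split; [exact: sosD | exact: sosD | ring].
  - move=> _ _ [s [t [Ss St ->]]] [u [v [Su Sv ->]]].
    exists (s * u + a ^+ 2 * (t * v)), (s * v + t * u); split; last by ring.
      by apply: sosD; [exact: sosM | apply: sosM; [exact: sosX | exact: sosM]].
    by apply: sosD; exact: sosM.
have [|R [f fT]] := real_closed_of_preordering prT.
  move=> [s [t [Ss St E]]]; apply: no; exists t, s; split=> //.
  by rewrite -[a * t](subKr s) -E; ring.
have : T (- a) by exists 0, 1; split; [exact: sos0 | exact: sos1 | ring].
by move=> /fT; rewrite rmorphN oppr_ge0 leNgt a_gt0.
Qed.

End SumsOfSquares.

(** * Symmetric matrices *)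

(** As [A] carries no order, definiteness is tested at every morphism to a real closed field. *)
Definition positive_definite (A : comNzRingType) n (H : 'M[A]_n) :=
  forall (R : rcfType) (f : {rmorphism A -> R}) (v : 'rV[R]_n),
    v != 0 -> 0 < (v *m map_mx f H *m v^T) 0 0.

Section Schur.
Variables (A : comNzRingType) (n : nat) (H : 'M[A]_(1 + n)).
Hypotheses (symH : H^T = H) (posH : positive_definite H).
Let h := H 0 0.
Let u : 'rV_n := ursubmx H.
(** This is [h] times the Schur complement of the corner, a form that avoids dividing by [h]. *)
Let G := h *: drsubmx H - u^T *m u.

Let HE : H = block_mx h%:M u u^T (drsubmx H).
Proof.
rewrite -[LHS]submxK; congr block_mx.
  by rewrite [ulsubmx H]mx11_scalar !mxE; congr (H _ _)%:M; apply: val_inj.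
by rewrite trmx_ursub symH.
Qed.

Lemma schur_sym : G^T = G.
Proof. by rewrite /G linearB linearZ /= trmx_drsub symH trmx_mul trmxK. Qed.

Lemma corner_gt0 (R : rcfType) (f : {rmorphism A -> R}) : 0 < f h.
Proof.
have v0 : delta_mx 0 0 != 0 :> 'rV[R]_(1 + n).
  by apply/eqP => /matrixP/(_ 0 0)/eqP; rewrite !mxE !eqxx oner_eq0.
have := posH f v0; rewrite trmx_delta -mulmxA -colE -rowE.
by rewrite !mxE.
Qed.

(** The vector [v] built from [w] is chosen so that the first entry of [v H] vanishes; the value of
    [H] at [v] is then [h] times the value of [G] at [w]. *)
Lemma schur_positive_definite : positive_definite G.
Proof.
move=> R f w w0; have fh := corner_gt0 f.
pose u' := map_mx f u; pose v : 'rV_(1 + n) := row_mx (- (w *m u'^T)) (f h *: w).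
have v0 : v != 0.
  apply: contra_neq w0 => v0; have := congr1 rsubmx v0; rewrite row_mxKr linear0.
  by move/eqP; rewrite scaler_eq0 gt_eqF //= => /eqP.
have vH : v *m map_mx f H = row_mx 0 (w *m map_mx f G).
  rewrite HE map_block_mx map_scalar_mx -map_trmx mul_row_block -/u'; congr row_mx.
    by rewrite mul_mx_scalar -scalemxAl scalerN addNr.
  rewrite /G map_mxB map_mxZ map_mxM -map_trmx -/u' mulmxBr -scalemxAr -scalemxAl.
  by rewrite mulNmx mulmxA addrC.
have := posH f v0; rewrite vH tr_row_mx mul_row_col mul0mx add0r linearZ /= -scalemxAr mxE.
by rewrite pmulr_rgt0.
Qed.

Lemma schur_decomposition :
  h *: H = (row_mx h%:M u)^T *m row_mx h%:M u + block_mx 0 0 0 G.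
Proof.
rewrite {1}HE scale_block_mx tr_row_mx mul_col_row tr_scalar_mx add_block_mx !addr0.
rewrite /G subrKC !mul_scalar_mx mul_mx_scalar.
by rewrite scale_scalar_mx.
Qed.


Definition sos_diagonalizable k (M : 'M[A]_k) :=
  exists (t : A) (d : 'rV[A]_k) (W : 'M[A]_k),
    [/\ sos t, forall i, sos (d 0 i) & (1 + t) *: M = W^T *m diag_mx d *m W].

(* Gaussian elimination: the pivot [h] is positive, hence invertible up to
   sums of squares by [positivstellensatz]. *)
Lemma schur_diagonalizable : sos_diagonalizable G -> sos_diagonalizable H.
Proof.
move=> [t [d [W [St Sd E]]]].
have [s [t' [Ss St' hs]]] := positivstellensatz corner_gt0.
(* With one added, this is [(1 + t) (1 + t')], which equals [(1 + t) s h]. The factor [h] feeds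
   [schur_decomposition], and [(1 + t) s] and [s] become the weights of the two blocks. *)
exists (t + t' + t * t').
exists (row_mx ((1 + t) * s)%:M (s *: d)).
exists (block_mx h%:M u 0 W); split.
- by apply: sosD; [exact: sosD | exact: sosM].
- move=> k; case: (split_ordP k) => j ->.
    by rewrite row_mxEl mxE !ord1 eqxx mulr1n; apply: sosM => //; apply: sosD => //; exact: sos1.
  by rewrite row_mxEr mxE; exact: sosM.
- have -> : 1 + (t + t' + t * t') = (1 + t) * s * h by rewrite -mulrA [s * h]mulrC hs; ring.
  rewrite -scalerA schur_decomposition scalerDr.
  have -> : ((1 + t) * s) *: block_mx 0 0 0 G =
      block_mx 0 0 0 (s *: (W^T *m diag_mx d *m W)) :> 'M_(1 + n).
    by rewrite scale_block_mx !scaler0 mulrC -scalerA E.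
  rewrite diag_mx_row tr_block_mx mulmx_block.
  rewrite !(mulmx0, mul0mx, addr0, add0r) mulmx_block.
  rewrite !(mulmx0, mul0mx, addr0, add0r) trmx0 !(mulmx0, mul0mx, addr0, add0r).
  rewrite tr_row_mx mul_col_row scale_block_mx add_block_mx !addr0.
  have diag1 c : diag_mx (c%:M : 'M_1) = c%:M :> 'M[A]_1.
    by apply/matrixP => i j; rewrite !mxE !ord1.
  by rewrite diag1 linearZ /= !(mul_mx_scalar ((1 + t) * s)) -!scalemxAr -!scalemxAl.
Qed.

End Schur.

Lemma sos_diagonalization (A : comNzRingType) n (H : 'M[A]_n) :
  H^T = H -> positive_definite H -> sos_diagonalizable H.
Proof.
elim: n H => [|n IHn] H symH posH.
  exists 0, 0, 0; split; [exact: sos0 | by case | by apply/matrixP => -[]].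
apply: (schur_diagonalizable symH posH); apply: IHn.
  exact: schur_sym.
exact: schur_positive_definite.
Qed.

(** * Norm inequalities and the scaling of a positive definite matrix *)

Section Frobenius.
Variable R : realFieldType.

(** By Lagrange's identity, twice the difference of the two sides is a double sum of squares. *)
Lemma cauchy_schwarz (I : finType) (a b : I -> R) :
  (\sum_i a i * b i) ^+ 2 <= (\sum_i a i ^+ 2) * (\sum_i b i ^+ 2).
Proof.
have : 0 <= \sum_i \sum_j (a i * b j - a j * b i) ^+ 2.
  by apply: sumr_ge0 => i _; apply: sumr_ge0 => j _; exact: sqr_ge0.
have -> : \sum_i \sum_j (a i * b j - a j * b i) ^+ 2 =
    2 * ((\sum_i a i ^+ 2) * (\sum_i b i ^+ 2) - (\sum_i a i * b i) ^+ 2).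
  rewrite expr2 !big_distrlr /= -sumrB.
  under [X in _ = 2 * X]eq_bigr do rewrite -sumrB.
  rewrite -[2 in RHS]/(1 + 1) mulrDl mul1r [X in _ = _ + X]exchange_big -big_split /=.
  apply: eq_bigr => i _; rewrite -big_split; apply: eq_bigr => j _ /=; ring.
lra.
Qed.

Lemma row_sqrE n (v : 'rV[R]_n) : (v *m v^T) 0 0 = \sum_i v 0 i ^+ 2.
Proof. by rewrite mxE; apply: eq_bigr => i _; rewrite mxE expr2. Qed.

Lemma row_sqr_gt0 n (v : 'rV[R]_n) : v != 0 -> 0 < (v *m v^T) 0 0.
Proof.
move=> v0; rewrite row_sqrE lt_def sumr_ge0 ?andbT => [|i _]; last exact: sqr_ge0.
apply: contra v0; rewrite psumr_eq0 => [/allP v0|i _]; last exact: sqr_ge0.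
apply/eqP/rowP => i; rewrite mxE; apply/eqP; rewrite -sqrf_eq0.
by apply: v0; rewrite mem_index_enum.
Qed.

(** Cauchy-Schwarz is applied to each column of [B]; the trace is the squared Frobenius norm of
    [B]. *)
Lemma frobenius_bound m n (y : 'rV[R]_m) (B : 'M[R]_(m, n)) :
  ((y *m B) *m (y *m B)^T) 0 0 <= (y *m y^T) 0 0 * \tr (B *m B^T).
Proof.
rewrite !row_sqrE mxtrace_mulC /mxtrace mulr_sumr; apply: ler_sum => j _.
rewrite !mxE; apply: le_trans (cauchy_schwarz _ _) _; rewrite ler_wpM2l //.
  by apply: sumr_ge0 => i _; exact: sqr_ge0.
by rewrite le_eqVlt; apply/orP; left; apply/eqP/eq_bigr => i _; rewrite mxE expr2.
Qed.

End Frobenius.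

(* With [H = V V^T] and [det H * s = 1 + t], the matrix [2 s tr(adj H) H - 1] is
   [2 (1 + t) |V^-1|^2 H - 1], and [|v|^2 <= |V^-1|^2 |v V|^2]. *)
Lemma scaled_sub1_positive_definite (A : comNzRingType) n (H : 'M[A]_n) :
  (forall (R : rcfType) (f : {rmorphism A -> R}),
     exists2 V : 'M[R]_n, V \in unitmx & map_mx f H = V *m V^T) ->
  exists c : A, positive_definite (c *: H - 1%:M).
Proof.
move=> gram.
have det_gt0 (R : rcfType) (f : {rmorphism A -> R}) : 0 < f (\det H).
  have [V uV HV] := gram R f; rewrite -det_map_mx HV det_mulmx det_tr -expr2.
  by rewrite lt_def sqr_ge0 andbT sqrf_eq0 -unitfE.
have [s [t [_ [l tE] ds]]] := positivstellensatz det_gt0.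
exists (2 * s * \tr (\adj H)) => R f v v0.
have [V uV HV] := gram R f; set B := invmx V.
(* The adjugate is the determinant times the inverse, and the inverse of [V V^T] is [B^T B]. *)
have adjH : map_mx f (\adj H) = f (\det H) *: (B^T *m B).
  have uH : map_mx f H \in unitmx by rewrite HV unitmx_mul uV unitmx_tr.
  have : \adj (map_mx f H) *m map_mx f H = f (\det H) *: (B^T *m B) *m map_mx f H.
    rewrite mul_adj_mx det_map_mx HV -scalemxAl -mulmxA (mulmxA B) mulVmx //.
    by rewrite mul1mx -trmx_mul mulmxV // trmx1 scalemx1.
  by move/(congr1 (mulmx^~ (invmx (map_mx f H)))); rewrite -!mulmxA !mulmxV // !mulmx1 map_mx_adj.
have cE : f (2 * s * \tr (\adj H)) = 2 * (1 + f t) * \tr (B *m B^T).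
  rewrite rmorphM -trace_map_mx adjH mxtraceZ mxtrace_mulC mulrA; congr (_ * _).
  by rewrite rmorphM rmorph_nat -mulrA -rmorphM [s * _]mulrC ds rmorphD rmorph1.
have ft_ge0 : 0 <= f t.
  by rewrite tE rmorph_sum sumr_ge0 // => a _; rewrite rmorphXn sqr_ge0.
rewrite map_mxB map_mxZ map_mx1 cE mulmxBr mulmx1 mulmxBl -scalemxAr -scalemxAl.
have -> : v *m map_mx f H *m v^T = (v *m V) *m (v *m V)^T.
  by rewrite HV trmx_mul !mulmxA.
have := frobenius_bound (v *m V) B; rewrite -[_ *m B]mulmxA mulmxV // mulmx1.
have := row_sqr_gt0 v0.
have subE c (M N : 'M[R]_1) : (c *: M - N) 0 0 = c * M 0 0 - N 0 0 by rewrite !mxE.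
rewrite {}subE; set x := (v *m v^T) 0 0; set y := (_ *m (v *m V)^T) 0 0 => x_gt0 xy.
(* Since [x] is at most [y] times the trace, the factor 2 leaves a margin of at least [x], which is
   positive. *)
have := mulr_ge0 ft_ge0 (le_trans (ltW x_gt0) xy).
nra.
Qed.

(** * Companion matrices and the trace form *)

Section Companion.
Variable A : comNzRingType.

(** The size is a separate parameter so that a polynomial and its image under a morphism give
    matrices of the same size without casts. *)
Definition companion n (f : {poly A}) : 'M[A]_n :=
  \matrix_(i, j) if i == n.-1 :> nat then - f`_j else (i.+1 == j :> nat)%:R.

Lemma char_poly_companion n (f : {poly A}) :
  f \is monic -> (size f).-1 = n -> char_poly (companion n f) = f.
Proof. by move=> mf <-; exact: companionmxK. Qed.

(** For a sequence [m] obeying the recurrence with coefficients [f], the companion matrix acts as a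
    shift; only its last row uses the recurrence. It serves below for traces of powers and for
    powers of a root. *)
Lemma companion_shift n (f : {poly A}) (M : lmodType A) (m : nat -> M) (i : 'I_n) :
  f \is monic -> size f = n.+1 -> \sum_(j < n.+1) f`_j *: m j = 0 ->
  \sum_j companion n f i j *: m j = m i.+1.
Proof.
move=> /monicP mf szf; have [iE|iN] := eqVneq (i : nat) n.-1.
  have nE : n = i.+1 by rewrite iE prednK // (leq_ltn_trans _ (ltn_ord i)).
  have fn : f`_n = 1 by rewrite -mf lead_coefE szf.
  rewrite big_ord_recr /= fn scale1r addrC.
  move=> /eqP; rewrite addr_eq0 -nE => /eqP ->; rewrite -sumrN.
  by apply: eq_bigr => j _; rewrite mxE iE eqxx scaleNr.
move=> _; have i1 : (i.+1 < n)%N by have := ltn_ord i; move: iN; lia.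
rewrite (bigD1 (Ordinal i1)) //= big1 ?addr0 => [|j jN].
  by rewrite mxE (negPf iN) eqxx scale1r.
by rewrite mxE (negPf iN) -[i.+1 == j]/(val (Ordinal i1) == val j) val_eqE eq_sym (negPf jN) scale0r.
Qed.

(** For the companion matrix of [f] this is the Gram matrix of the trace form of [A[X]/(f)] in the
    basis of powers of [X], known as Hermite's form. *)
Definition hankel_trace n (C : 'M[A]_n) : 'M[A]_n := \matrix_(i, j) \tr (C ^+ (i + j)).

Lemma hankel_trace_sym n (C : 'M[A]_n) : (hankel_trace C)^T = hankel_trace C.
Proof. by apply/matrixP => i j; rewrite !mxE addnC. Qed.

(** By Cayley-Hamilton the traces of powers obey the recurrence of [f], so [C H] is again a Hankel
    matrix, hence symmetric, and it equals its transpose [H C^T]. *)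
Lemma companion_hankel n (f : {poly A}) :
  f \is monic -> size f = n.+1 ->
  companion n f *m hankel_trace (companion n f) =
  hankel_trace (companion n f) *m (companion n f)^T.
Proof.
move=> mf szf; set C := companion n f; set H := hankel_trace C.
have CH i k : (C *m H) i k = \tr (C ^+ (i + k).+1).
  pose m j : A^o := \tr (C ^+ (j + k)).
  rewrite mxE -[RHS]/(m i.+1) -(companion_shift i mf szf); last first.
    transitivity (\tr (C ^+ k *m \sum_(j < n.+1) f`_j *: C ^+ j)).
      rewrite mulmx_sumr linear_sum; apply: eq_bigr => j _.
      by rewrite -scalemxAr linearZ /= -[_ *m _]/(C ^+ k * C ^+ j) -exprD addnC.
    rewrite [X in _ *m X](_ : _ = 0) ?mulmx0 ?mxtrace0 //.
    case: n @C @H i {k m} mf szf => [|n] C H i mf szf; first by case: i.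
    have := Cayley_Hamilton C; rewrite char_poly_companion // ?szf //.
    rewrite -[X in horner_mx C X]coefK poly_def szf linear_sum => {2}<-.
    by apply: eq_bigr => j _; rewrite linearZ /= rmorphXn /= horner_mx_X.
  by apply: eq_bigr => j _; rewrite [H j k]mxE.
apply/matrixP => i k; rewrite CH addnC -CH.
by rewrite -[H in RHS]hankel_trace_sym -trmx_mul [RHS]mxE.
Qed.

End Companion.

(* The Vandermonde matrix of [s] diagonalizes the companion matrix. *)
Lemma hankel_trace_gram (R : fieldType) n (f : {poly R}) (s : seq R) :
  f \is monic -> size f = n.+1 -> uniq s -> f = \prod_(x <- s) ('X - x%:P) ->
  exists2 V : 'M[R]_n, V \in unitmx & hankel_trace (companion n f) = V *m V^T.
Proof.
move=> mf szf us fE; have szs : size s = n.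
  by move: szf; rewrite fE size_prod_XsubC => -[].
pose a : 'rV[R]_n := \row_i s`_i; pose V := Vandermonde n a.
have uV : V \in unitmx.
  rewrite unitmxE det_Vandermonde unitfE; apply/prodf_neq0 => i _; apply/prodf_neq0 => j ij.
  by rewrite !mxE subr_eq0 nth_uniq ?szs // gtn_eqF.
exists V => //; set C := companion n f.
(* The powers of a root of [f] obey the recurrence of [f], so the columns of [V] are eigenvectors of
   [C]. *)
have CV : C *m V = V *m diag_mx a.
  apply/matrixP => i l; rewrite mul_mx_diag !mxE -exprSr.
  have := @companion_shift _ n f R^o (fun j => s`_l ^+ j) i mf szf.
  move=> /(_ _) <-; first by apply: eq_bigr => j _; rewrite !mxE.
  have : f.[s`_l] = 0 by apply/rootP; rewrite fE root_prod_XsubC mem_nth ?szs.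
  by rewrite (@horner_coef_wide _ n.+1) ?szf.
have CE : C = V *m diag_mx a *m invmx V by rewrite -CV mulmxK.
have CX k : C ^+ k *m V = V *m diag_mx (\row_i s`_i ^+ k).
  elim: k => [|k IHk].
    rewrite expr0 mul1mx; apply/matrixP => i j; rewrite mul_mx_diag !mxE expr0 mulr1 //.
  rewrite exprSr -[_ * _]/(C ^+ k *m C) -mulmxA CV mulmxA IHk -mulmxA.
  by congr (_ *m _); apply/matrixP => i j; rewrite mul_diag_mx !mxE mulrnAr exprSr.
apply/matrixP => i j; rewrite !mxE.
rewrite -[C ^+ _](mulmxK uV) CX mxtrace_mulC mulmxA mulVmx // mul1mx mxtrace_diag.
by apply: eq_bigr => k _; rewrite !mxE exprD.
Qed.

(** * Symmetric dilation of a matrix and Gram factorizations *)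

Section SymmetricDilation.
Variables (A : comNzRingType).

Lemma char_poly_conj n (L K M : 'M[A]_n) : L *m K = 1%:M ->
  char_poly (L *m M *m K) = char_poly M.
Proof.
move=> LK; have KL := mulmx1C LK; rewrite /char_poly.
have -> : char_poly_mx (L *m M *m K) =
    map_mx polyC L *m char_poly_mx M *m map_mx polyC K.
  rewrite /char_poly_mx mulmxBr mulmxBl !map_mxM /=; congr (_ - _).
  by rewrite mul_mx_scalar -scalemxAl -map_mxM LK map_mx1 scalemx1.
rewrite !det_mulmx mulrAC -det_mulmx -map_mxM LK map_mx1 det1 mul1r //.
Qed.

Lemma char_poly_lblock m n (P : 'M[A]_m) (Q : 'M[A]_(n, m)) (S : 'M[A]_n) :
  char_poly (block_mx P 0 Q S) = char_poly P * char_poly S.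
Proof.
rewrite /char_poly /char_poly_mx map_block_mx scalar_mx_block opp_block_mx add_block_mx.
by rewrite map_mx0 oppr0 add0r det_lblock.
Qed.

(* The witness [M] satisfies [row_mx 1 N *m M = C *m row_mx 1 N]. *)
Lemma symmetric_dilation n m (C : 'M[A]_n) (N : 'M[A]_(n, m)) :
  C *m (1%:M + N *m N^T) = (1%:M + N *m N^T) *m C^T ->
  exists M : 'M[A]_(n + m), M^T = M /\ exists g, char_poly M = char_poly C * g.
Proof.
move=> CP; pose X := C *m N; pose S := C - N *m X^T.
exists (block_mx S X X^T 0); split.
  rewrite tr_block_mx trmxK trmx0; congr block_mx.
  (* In this form the symmetry is visible: the hypothesis [CP] says that the subtracted product is
     its own transpose. *)
  have SE : S = C + C^T - (1%:M + N *m N^T) *m C^T.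
    by rewrite mulmxDl mul1mx -mulmxA -trmx_mul -/X /S opprD addrA addrK.
  rewrite SE linearB /= [(_ + C^T)^T]linearD /= !trmx_mul !trmxK linearD /= trmx1 trmx_mul trmxK.
  by rewrite CP [C^T + C]addrC.
exists (char_poly (- (X^T *m N))).
(* Conjugation by the unipotent matrix with top row [row_mx 1 N] makes [M] block lower triangular,
   with [C] and [- (X^T *m N)] on the diagonal. *)
rewrite -(@char_poly_conj _ (block_mx 1%:M N 0 1%:M) (block_mx 1%:M (- N) 0 1%:M)).
  rewrite !mulmx_block !(mul1mx, mul0mx, mulmx0, mulmx1, addr0, add0r).
  by rewrite /S subrK mulmxN -/X addNr mulmxN char_poly_lblock.
by rewrite mulmx_block !(mul1mx, mul0mx, mulmx0, mulmx1, addr0, add0r) addNr -scalar_mx_block.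
Qed.

Lemma gram_concat n m (B : 'I_m -> 'M[A]_n) :
  exists N : 'M[A]_(n, m * n), N *m N^T = \sum_i B i *m (B i)^T.
Proof.
elim: m B => [|m IHm] B.
  by exists 0; rewrite big_ord0 mul0mx.
have [N NE] := IHm (fun i => B (lift ord0 i)).
exists (row_mx (B ord0) N : 'M_(n, n + m * n)).
by rewrite tr_row_mx mul_row_col big_ord_recl NE.
Qed.

End SymmetricDilation.

Definition sum_of_squares (A : comNzRingType) m (x : A) :=
  exists v : 'I_m -> A, x = \sum_(i < m) v i ^+ 2.

Lemma sum_of_squares_widen (A : comNzRingType) m k (x : A) :
  (m <= k)%N -> sum_of_squares m x -> sum_of_squares k x.
Proof.
move=> /subnKC <- [v ->].
exists (fun i => if split i is inl j then v j else 0).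
rewrite big_split_ord /= [X in _ + X]big1 ?addr0 => [|i _].
  by apply: eq_bigr => i _; rewrite (unsplitK (inl i)).
by rewrite (unsplitK (inr i)) expr0n.
Qed.

(** Padding with zeros equalizes the lengths of finitely many sums of squares; this replaces the
    uniform bound when the Pythagoras number is infinite. *)
Lemma common_length (A : comNzRingType) (I : finType) (x : I -> A) :
  (forall i, sos (x i)) -> exists m, forall i, sum_of_squares m (x i).
Proof.
move=> Sx; have /choice[l lP] i : exists m, sum_of_squares m (x i).
  have [s ->] := Sx i; exists (size s), (fun i => s`_i).
  by rewrite (big_nth 0) big_mkord.
exists (\max_i l i) => i; apply: sum_of_squares_widen (lP i).
exact: leq_bigmax.
Qed.

(* [N] has one square block for each of the [m] squares summing to [t], and one
   for each [i < m], built from the [i]-th squares in all the entries of [d]. *)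
Lemma gram_of_diagonalization (A : comNzRingType) n m (t : A) (d : 'rV[A]_n) (W : 'M[A]_n) :
  sum_of_squares m t -> (forall i, sum_of_squares m (d 0 i)) ->
  exists N : 'M[A]_(n, m * n + m * n),
    N *m N^T = t%:M + W^T *m diag_mx d *m W.
Proof.
move=> [u ->] /choice[v vE].
have [N1 N1E] := gram_concat (fun i => (u i)%:M : 'M[A]_n).
have [N2 N2E] := gram_concat (fun i => W^T *m diag_mx (\row_k v k i)).
exists (row_mx N1 N2); rewrite tr_row_mx mul_row_col N1E N2E; congr (_ + _).
  rewrite raddf_sum; apply: eq_bigr => i _.
  by rewrite tr_scalar_mx -scalar_mxM expr2.
have -> : diag_mx d = \sum_i diag_mx (\row_k v k i ^+ 2).
  rewrite -linear_sum; congr diag_mx; apply/rowP => k; rewrite vE summxE.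
  by apply: eq_bigr => i _; rewrite mxE.
rewrite mulmx_sumr mulmx_suml; apply: eq_bigr => i _.
rewrite trmx_mul trmxK tr_diag_mx !mulmxA; congr (_ *m _).
rewrite -[LHS]mulmxA; congr (_ *m _); apply/matrixP => k l; rewrite mul_diag_mx !mxE.
by rewrite mulrnAr expr2.
Qed.

Theorem theorem4p1 (A : comNzRingType) (f : {poly A}) (n : nat) (p : option nat)
  (hf : strict_real_zero_poly f) (hdeg : (size f).-1 = n)
  (hp : pythagoras_number A p) :
  exists (r : nat) (M : 'M[A]_r),
    match p with Some q => (r <= (2 * q + 1) * n)%N | None => True end /\
    M^T = M /\
    exists g : {poly A}, char_poly M = f * g.
Proof.
have [mf roots] := hf.
have szf : size f = n.+1 by rewrite -hdeg prednK // size_poly_gt0 monic_neq0.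
pose C := companion n f; pose H := hankel_trace C.
have gram (R : rcfType) (phi : {rmorphism A -> R}) :
    exists2 V : 'M[R]_n, V \in unitmx & map_mx phi H = V *m V^T.
  have [s [us fE]] := roots R phi.
  have mf' : map_poly phi f \is monic by exact: monic_map.
  have szf' : size (map_poly phi f) = n.+1 by rewrite size_map_poly_id0 // (monicP mf) rmorph1 oner_neq0.
  have [V uV VE] := hankel_trace_gram mf' szf' us fE; exists V => //; rewrite -VE.
  have CE : map_mx phi C = companion n (map_poly phi f).
    apply/matrixP => i j; rewrite !mxE coef_map; case: ifP => _; first exact: rmorphN.
    exact: rmorph_nat.
  apply/matrixP => i j; rewrite !mxE -CE -trace_map_mx; congr (\tr _).
  by elim: (i + j)%N => [|k IHk]; rewrite ?expr0 ?map_mx1 // !exprS map_mxM IHk.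
have [c posH] := scaled_sub1_positive_definite gram.
have symH : (c *: H - 1%:M)^T = c *: H - 1%:M.
  by rewrite linearB linearZ /= hankel_trace_sym trmx1.
have [t [d [W [St Sd E]]]] := sos_diagonalization symH posH.
(* A finite Pythagoras number [q] is itself a common length, which gives the bound on the size;
   otherwise any common length will do. *)
have [m [mp tm dm]] : exists m, [/\ if p is Some q then m = q else True,
    sum_of_squares m t & forall i, sum_of_squares m (d 0 i)].
  case: p hp => [q [hq _]|_].
    by exists q; split=> // [|i]; [case: St | case: (Sd i)] => s ->; exact: hq.
  pose x (i : option 'I_n) := if i is Some j then d 0 j else t.
  have [|m mE] := @common_length _ _ x; first by case.
  by exists m; split=> // [|i]; [exact: (mE None) | exact: (mE (Some i))].
have [N NE] := gram_of_diagonalization W tm dm.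
(* The summand [t] in [N N^T] completes [1] to [1 + t], which cancels the [- 1] in
   [(1 + t) (c H - 1)]. What remains is a scalar multiple of [H], and [companion_hankel] applies to
   it. *)
have PE : 1%:M + N *m N^T = ((1 + t) * c) *: H.
  rewrite NE -E scalerBr scalerA addrA [1%:M + _]addrC scalemx1 raddfD /=.
  by rewrite [t%:M + _]addrC addrC subrK.
have [|M [symM [g charM]]] := @symmetric_dilation _ _ _ C N.
  by rewrite PE -scalemxAr -scalemxAl companion_hankel.
exists (n + (m * n + m * n))%N, M; split; last split=> //.
  by case: p mp {hp} => // q ->; rewrite leq_eqVlt; apply/orP; left; apply/eqP; lia.
by exists g; rewrite charM char_poly_companion.
Qed.
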